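(* Let $p\in[1,\infty[$. Then $Z(\ell_p)$ is not spaceable in $\ell_p$; that is, there is no infinite dimensional closed linear subspace $Y$ of $\ell_p$ with $Y\subset Z(\ell_p)\cup\{0\}$.
   Context: All sequence spaces are over $\mathbb{C}$. $Z(\ell_p)$ denotes the set of all sequences in $\ell_p$ having only finitely many zero coordinates. A subset $M$ of a topological vector space $X$ is spaceable in $X$ if there is an infinite dimensional closed linear subspace $Y$ of $X$ with $Y\subset M\cup\{0\}$. *)

(* Defs.v *)
From HB Require Import structures.
From mathcomp Require Import all_boot all_order all_algebra.
From mathcomp Require Import complex.
From mathcomp Require Import all_classical all_reals all_analysis.

Set Implicit Arguments.
Unset Strict Implicit.
Unset Printing Implicit Defensive.

Import Order.TTheory GRing.Theory Num.Theory.
Import ComplexField.Normc.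

Local Open Scope classical_set_scope.
Local Open Scope ring_scope.
Local Open Scope complex_scope.

Definition linear_subspace (K : numFieldType) (X : lmodType K) (Y : set X) :=
  submod_closed (mem Y).

(* For a linear subspace Y: Y is the span of finitely many vectors. *)
Definition finite_dimensional (K : numFieldType) (X : lmodType K) (Y : set X) :=
  exists (n : nat) (e : 'I_n -> X),
    Y = [set \sum_(i < n) c i *: e i | c in [set: 'I_n -> K]].

Definition spaceable (K : numFieldType) (X : topologicalLmodType K)
    (M : set X) :=
  exists Y : set X,
    [/\ linear_subspace Y, closed Y, ~ finite_dimensional Y
      & Y `<=` M `|` [set 0]].

Section lp_norm.
Context (R : realType).
Implicit Types (p : R) (x y : nat -> R[i]).

(* [normc] is the complex modulus with values in R. *)
Definition lp_norm p x : \bar R :=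
  Lnorm counting p%:E (fun k => (normc (x k))%:E).

Lemma normc_ge0 (z : R[i]) : 0 <= normc z.
Proof. by case: z => a b; exact: sqrtr_ge0. Qed.

Lemma lp_normE p x : 0 < p ->
  (lp_norm p x = (\sum_(0 <= k <oo) (normc (x k) `^ p)%:E) `^ p^-1)%E.
Proof.
move=> p0; rewrite /lp_norm Lnorm_counting//.
congr (_ `^ _)%E; apply: eq_eseriesr => k _.
by rewrite abse_EFin poweR_EFin ger0_norm// normc_ge0.
Qed.

Lemma lp_normD p x y : 1 <= p ->
  (lp_norm p (x + y)%R <= lp_norm p x + lp_norm p y)%E.
Proof.
move=> p1; have p0 : 0 < p by exact: lt_le_trans p1.
have := @minkowski_EFin _ nat R counting
  (fun k => normc (x k)) (fun k => normc (y k)) p.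
move=> /(_ (fun _ _ _ => I) (fun _ _ _ => I) p1); apply: le_trans.
rewrite /lp_norm !Lnorm_counting//.
have s0 (f : nat -> \bar R) :
    (\sum_(0 <= k <oo) `|f k| `^ p)%E \in `[0%E, +oo%E].
  rewrite in_itv/= leey andbT.
  by apply: nneseries_ge0 => k _ _; exact: poweR_ge0.
apply: gt0_ler_poweR => //; first by rewrite invr_ge0 ltW.
apply: lee_nneseries => k _; first by move=> _; exact: poweR_ge0.
rewrite lee_fin; apply: ge0_ler_powR; rewrite ?nnegrE//; first exact: ltW.
rewrite /= !ger0_norm ?addr_ge0 ?normc_ge0// -lecR rmorphD/=.
exact: (@ler_normD _ R[i] (x k) (y k)).
Qed.

Lemma lp_normZ p (a : R[i]) x : 0 < p ->
  (lp_norm p (a *: x)%R = (normc a)%:E * lp_norm p x)%E.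
Proof.
move=> p0; rewrite !lp_normE//.
under eq_eseriesr do rewrite normcM powRM ?normc_ge0// EFinM.
rewrite nneseriesZl; last by move=> k _; rewrite lee_fin powR_ge0.
rewrite poweRM ?lee_fin ?powR_ge0//; last first.
  by apply: nneseries_ge0 => k _ _; rewrite lee_fin powR_ge0.
by rewrite poweR_EFin -powRrM mulfV ?gt_eqF// powRr1// normc_ge0.
Qed.

Lemma lp_norm_eq0 p x : 0 < p -> lp_norm p x = 0%E -> x = 0.
Proof.
move=> p0; rewrite lp_normE//.
have x_ge0 k : (0 <= (normc (x k) `^ p)%:E)%E by rewrite lee_fin powR_ge0.
move=> /poweR_eq0_eq0-/(_ (nneseries_ge0 (fun k _ _ => x_ge0 k))) x0.
apply/funext => k; apply: eq0_normc; apply: (@powR_eq0_eq0 _ _ p).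
move: x0; rewrite (nneseriesD1 (fun k _ => x_ge0 k) (n := k))// => /eqP.
rewrite padde_eq0//; last by apply: nneseries_ge0.
by move=> /andP[/eqP[]].
Qed.

Definition lp_pred p : {pred nat -> R[i]} := mem [set x | lp_norm p x < +oo]%E.

Lemma lp_submod_closed p : 1 <= p -> submod_closed (lp_pred p).
Proof.
move=> p1; have p0 : 0 < p by exact: lt_le_trans p1.
split.
  by rewrite inE/= -(scale0r 0) lp_normZ// normc0 mul0e.
move=> a x y; rewrite !inE/= => xp yp; apply: le_lt_trans (lp_normD _ _ p1) _.
rewrite lp_normZ// lte_add_pinfty// lte_mul_pinfty// ?lee_fin ?normc_ge0//.
Qed.

End lp_norm.

(* The bound [p1] is a parameter because the triangle inequality, hence the
   canonical normed structure on [lp p1], depends on it. *)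
Record lp (R : realType) (p : R) (p1 : 1 <= p) := Lp {
  lp_val :> nat -> R[i] ;
  lp_valP : lp_val \in lp_pred p }.

Section lp_space.
Context (R : realType) (p : R) (p1 : 1 <= p).

HB.instance Definition _ := [isSub for @lp_val R p p1].
HB.instance Definition _ := [Choice of lp p1 by <:].
#[local] HB.instance Definition _ := GRing.isSubmodClosed.Build _ _ (lp_pred p)
  (lp_submod_closed p1).
HB.instance Definition _ := [SubChoice_isSubLmodule of lp p1 by <:].

Let p0 : 0 < p := lt_le_trans ltr01 p1.

Let norm (x : lp p1) : R[i] := (fine (lp_norm p x))%:C.

Let lp_norm_fineK (x : lp p1) : (fine (lp_norm p x))%:E = lp_norm p x.
Proof.
rewrite fineK// ge0_fin_numE ?Lnorm_ge0//.
by have := lp_valP x; rewrite inE.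
Qed.

Let norm_ler_normD (x y : lp p1) : norm (x + y) <= norm x + norm y.
Proof.
rewrite -rmorphD lecR -lee_fin EFinD !lp_norm_fineK.
exact: lp_normD.
Qed.

Let norm_normrZ (a : R[i]) (x : lp p1) : norm (a *: x) = `|a| * norm x.
Proof.
rewrite -rmorphM/=; congr (_%:C); apply: EFin_inj.
by rewrite EFinM !lp_norm_fineK; exact: lp_normZ.
Qed.

Let norm_normr0_eq0 (x : lp p1) : norm x = 0 -> x = 0.
Proof.
move=> [nx0]; apply/val_inj/(lp_norm_eq0 p0).
by rewrite -lp_norm_fineK nx0.
Qed.

HB.instance Definition _ := Lmodule_isNormed.Build R[i] (lp p1)
  norm_ler_normD norm_normrZ norm_normr0_eq0.

Lemma lp_normrE (x : lp p1) : `|x| = (fine (lp_norm p x))%:C.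
Proof. by []. Qed.

End lp_space.

Definition Zlp (R : realType) (p : R) (p1 : 1 <= p) : set (lp p1) :=
  [set x | finite_set [set n | x n = 0]].
Arguments Zlp {R p} p1 _.

(* Main.v *)
Require Import Defs.
From HB Require Import structures.
From mathcomp Require Import all_boot all_order all_algebra.
From mathcomp Require Import complex.
From mathcomp Require Import all_classical all_reals all_analysis.

Import Order.TTheory GRing.Theory Num.Theory.

Local Open Scope ring_scope.

(** Why every infinite-dimensional closed subspace Y of l_p contains a nonzero
vector with infinitely many zeros.

An infinite-dimensional Y has nonzero vectors vanishing on any prescribed
initial segment of coordinates ([exists_common_zero]). Given x in l_p, a bound
e and an initial segment [0, M), enlarge M until the tail of x has norm below
e, and let h in Y have norm e and vanish on that segment. Then h cannot be
dominated by x coordinate by coordinate, so |x n| < |h n| for some n, and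
g := (x n / h n) h is a vector of Y of norm at most e that vanishes on [0, M)
and agrees with x at n ([lp_correction]).

Start from a nonzero x_0 in Y and put x_(k+1) := x_k - g_k, where g_k corrects
x_k at a coordinate n_k, has norm at most 2^-(k+1) and vanishes on [0, M_k);
take M_(k+1) := n_k + 1, so that later corrections keep the zero created at
n_k. Since the M_k increase strictly, each coordinate of x_k is eventually
constant. This defines the limit sequence, and every initial segment of
limit - x_k is an initial segment of some x_j - x_k, whose norm is at most
2^-k; hence limit - x_k is in l_p with norm at most 2^-k
([lp_of_local_bound]). As Y is closed it contains the limit, which vanishes at
all n_k, and which is nonzero because M_0 is chosen beyond a nonzero coordinate
of x_0 ([subspace_zeros]). *)

(** * Infinite-dimensional subspaces and linear functionals *)

(** A functional cuts the dimension by at most one: if v in Y is not killed by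
phi, then Y is spanned by v together with the kernel of phi on Y. *)
Lemma finite_dimensional_ker (K : numFieldType) (X : lmodType K) (Y : set X)
    (phi : {scalar X}) : linear_subspace Y ->
  finite_dimensional (Y `&` [set y | phi y = 0])%classic ->
  finite_dimensional Y.
Proof.
move=> [Y0 YD] [n [e eE]].
have YD' a x y : Y x -> Y y -> Y (a *: x + y).
  by move=> Yx Yy; have := YD a x y; rewrite !inE; exact.
have [Yker|/existsNP[v /not_implyP[Yv /eqP phiv]]] :=
    pselect (forall y, Y y -> phi y = 0).
  exists n, e; rewrite -eE; apply/seteqP.
  by split=> [y Yy|y [] //]; split=> //=; exact: Yker.
exists n.+1, (fun i => if unlift ord0 i is Some j then e j else v).
have sumE c :
    \sum_(i < n.+1) c i *: (if unlift ord0 i is Some j then e j else v)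
    = c ord0 *: v + \sum_(i < n) c (lift ord0 i) *: e i.
  rewrite big_ord_recl unlift_none; congr (_ + _).
  by apply: eq_bigr => i _; rewrite liftK.
apply/seteqP; split=> [y Yy|y [c _ <-]].
  pose a := phi y / phi v.
  have : (Y `&` [set y | phi y = 0])%classic (y - a *: v).
    split; first by rewrite addrC -scaleNr; exact: YD'.
    by rewrite /= linearB linearZ /= /a divfK// subrr.
  rewrite eE => -[c _ cE].
  exists (fun i => if unlift ord0 i is Some j then c j else a) => //.
  rewrite sumE unlift_none.
  under eq_bigr do rewrite liftK.
  by rewrite cE addrC subrK.
rewrite sumE; apply: YD' => //.
suff [] : (Y `&` [set y | phi y = 0])%classic
    (\sum_(i < n) c (lift ord0 i) *: e i).
  by [].
by rewrite eE; exists (fun i => c (lift ord0 i)).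
Qed.

(** By induction, Y intersected with the kernels of finitely many functionals
remains infinite-dimensional, hence nonzero. *)
Lemma exists_common_zero (K : numFieldType) (X : lmodType K) (Y : set X)
    (phi : nat -> {scalar X}) (M : nat) :
  linear_subspace Y -> ~ finite_dimensional Y ->
  exists y, [/\ Y y, y != 0 & forall i, (i < M)%N -> phi i y = 0].
Proof.
elim: M Y => [|M IH] Y Ysub Yinf.
  apply: contra_notP Yinf => /forallNP Y0.
  exists 0%N, (fun=> 0); apply/seteqP; split=> [y Yy|y [c _ <-]].
    exists (fun=> 0) => //; rewrite big_ord0.
    by apply/esym/eqP; apply: contra_notT (Y0 y) => ?.
  by rewrite big_ord0; case: Ysub; rewrite inE.
have Zsub : linear_subspace (Y `&` [set y | phi M y = 0])%classic.
  case: Ysub => Y0 YD; split.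
    by move: Y0; rewrite !inE => Y0; split=> //=; exact: linear0.
  move=> a x y; rewrite !inE => -[Yx /= x0] [Yy /= y0]; split=> /=.
    by have := YD a x y; rewrite !inE; exact.
  by rewrite linearP x0 y0 /= mulr0 addr0.
have [|y [[Yy yM] yn0 y0]] := IH _ Zsub.
  by move=> h; apply: Yinf; exact: finite_dimensional_ker Ysub h.
exists y; split=> // i; rewrite ltnS leq_eqVlt => /predU1P[->//|]; exact: y0.
Qed.

(** * Norm estimates in l_p *)

Section lp_tools.
Context {R : realType} {p : R} (p1 : 1 <= p).
Local Open Scope complex_scope.
Import ComplexField.Normc.

Let p0 : 0 < p := lt_le_trans ltr01 p1.

Let pow_ge0 (x : nat -> R[i]) k : (0 <= (normc (x k) `^ p)%:E)%E.
Proof. by rewrite lee_fin powR_ge0. Qed.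

(** Comparing p-th powers removes the outer root, so that norm bounds become
bounds on nonnegative series. *)
Lemma lp_norm_leE (x : nat -> R[i]) (r : R) : 0 <= r ->
  (lp_norm p x <= r%:E)%E =
  (\sum_(0 <= k <oo) (normc (x k) `^ p)%:E <= (r `^ p)%:E)%E.
Proof.
move=> r0; rewrite lp_normE//.
set S := (\sum_(0 <= k <oo) _)%E.
have S0 : (0 <= S)%E by apply: nneseries_ge0 => k _ _; exact: pow_ge0.
have in0 (a : \bar R) : (0 <= a)%E -> a \in `[0%E, +oo%E].
  by move=> a0; rewrite in_itv/= a0 leey.
have K (a : \bar R) : (0 <= a)%E -> ((a `^ p^-1) `^ p)%E = a.
  by move=> a0; rewrite -poweRrM mulVf ?gt_eqF// poweRe1.
have rE : r%:E = ((r `^ p)%:E `^ p^-1)%E.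
  by rewrite poweR_EFin -powRrM mulfV ?gt_eqF// powRr1.
rewrite rE; apply/idP/idP => h.
  have := gt0_ler_poweR (ltW p0) (in0 _ (poweR_ge0 _ _))
    (in0 _ (poweR_ge0 _ _)) h.
  by rewrite !K// lee_fin powR_ge0.
apply: gt0_ler_poweR h; rewrite ?invr_ge0 ?(ltW p0)//; apply: in0 => //.
by rewrite lee_fin powR_ge0.
Qed.

Lemma lp_normr_leE (x : lp p1) (r : R) :
  (`|x| <= r%:C) = (lp_norm p x <= r%:E)%E.
Proof.
rewrite lp_normrE lecR -lee_fin fineK// ge0_fin_numE ?Lnorm_ge0//.
by have := lp_valP x; rewrite inE.
Qed.

Lemma lp_normr_real (x : lp p1) : exists2 r : R, 0 <= r & `|x| = r%:C.
Proof.
by exists (fine (lp_norm p x)); rewrite ?lp_normrE// fine_ge0// Lnorm_ge0.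
Qed.

(** The power sums up to N see the first N coordinates only, so a norm bound can
be checked on initial segments. This provides the limit vectors below: it
yields membership in l_p as well as the bound. *)
Lemma lp_of_local_bound (f : nat -> R[i]) (r : R) : 0 <= r ->
  (forall N, exists2 y : lp p1, `|y| <= r%:C &
    forall i, (i < N)%N -> y i = f i) ->
  exists2 z : lp p1, `|z| <= r%:C & lp_val z = f.
Proof.
move=> r0 H.
have fr : (lp_norm p f <= r%:E)%E.
  rewrite lp_norm_leE//; apply: lime_le.
    by apply: is_cvg_nneseries => k _ _; exact: pow_ge0.
  apply: nearW => N; have [y + yf] := H N.
  rewrite lp_normr_leE lp_norm_leE//; apply: le_trans.
  apply: le_trans (nneseries_lim_ge N _); last by move=> k _ _; exact: pow_ge0.
  by rewrite big_nat [leRHS]big_nat; under eq_bigr => i iN do rewrite -yf//.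
have fp : f \in lp_pred p by rewrite inE/=; exact: le_lt_trans fr (ltry _).
by exists (Lp p1 fp) => //; rewrite lp_normr_leE.
Qed.

(** The tails of the convergent power series of x tend to 0; M is chosen for x
alone and serves all vectors dominated by a tail of x. *)
Lemma lp_small_tail (x : lp p1) (e : R) : 0 < e ->
  exists M, forall (g : lp p1) N, (M <= N)%N ->
    (forall i, (i < N)%N -> g i = 0) ->
    (forall i, (N <= i)%N -> normc (g i) <= normc (x i)) -> `|g| <= e%:C.
Proof.
move=> e0.
have xfin : (\sum_(0 <= k <oo) (normc (x k) `^ p)%:E < +oo)%E.
  have [r r0 xr] := lp_normr_real x.
  have : `|x| <= r%:C by rewrite xr.
  by rewrite lp_normr_leE lp_norm_leE// => /le_lt_trans; apply; exact: ltry.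
have := nneseries_tail_cvg xfin (fun k _ => pow_ge0 x k).
have : nbhs 0%E [set y : \bar R | (y < (e `^ p)%:E)%E]%classic.
  by apply: open_ereal_lt_ereal; rewrite /= lte_fin powR_gt0.
move=> /[swap] /[apply] -[M _ tailM].
exists M => g N MN g0 gx; rewrite lp_normr_leE lp_norm_leE ?(ltW e0)//.
apply: le_trans (ltW (tailM N MN)) => /=.
rewrite (eseries_cond _ xpredT N).
rewrite (eseries_mkcond (P := fun i => true && (N <= i)%N)).
apply: lee_nneseries => [k _ _|k _]; first exact: pow_ge0.
case: ifPn => [/= Nk|]; last first.
  by rewrite /= -ltnNge => /g0 ->; rewrite normc0 powR0// gt_eqF.
by rewrite lee_fin ge0_ler_powR ?nnegrE ?normc_ge0 ?gx// ltW.
Qed.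

(** * Correcting one coordinate within the subspace *)

Definition lp_coord (n : nat) (x : lp p1) : R[i] := x n.

HB.instance Definition _ n := GRing.isLinear.Build
  R[i] (lp p1) R[i] _ (lp_coord n) (fun a x y => erefl (a * x n + y n)).

(** The corrector is a multiple of a vector h of Y of norm e vanishing far out:
were h dominated by x everywhere, h would be as small as a tail of x. *)
Lemma lp_correction (Y : set (lp p1)) (x : lp p1) (M : nat) (e : R) :
  linear_subspace Y -> ~ finite_dimensional Y -> 0 < e ->
  exists g n, [/\ Y g, (M <= n)%N, forall i, (i < M)%N -> g i = 0,
    `|g| <= e%:C & g n = x n].
Proof.
move=> Ysub Yinf e0; have [Y0 YD] := Ysub.
have YZ a y : Y y -> Y (a *: y).
  by move=> Yy; have := YD a y 0; rewrite addr0 !inE; apply=> //;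
    move: Y0; rewrite inE.
(* Any bound strictly below e serves; it must contradict |h| = e. *)
have [M' tailM'] := lp_small_tail x (e / 2) (divr_gt0 e0 (ltr0n _ 2)).
pose N := maxn M M'.
have [y [Yy yn0 y0]] :=
  exists_common_zero _ _ _ (fun i => lp_coord i : {scalar lp p1}) N Ysub Yinf.
have [r r0 yr] := lp_normr_real y.
have rgt0 : 0 < r.
  rewrite lt_neqAle r0 andbT eq_sym; apply: contra_neq yn0 => r00.
  by apply/eqP; rewrite -normr_eq0 yr r00.
pose h := (e / r)%:C *: y.
have Yh : Y h by exact: YZ.
have hE : `|h| = e%:C.
  rewrite normrZ yr ger0_norm ?ler0c ?divr_ge0 ?(ltW e0)//.
  by rewrite -rmorphM/= divfK// gt_eqF.
have h0 i : (i < N)%N -> h i = 0.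
  move=> iN; rewrite /h [LHS](_ : _ = (e / r)%:C * y i)//.
  by rewrite (y0 _ iN : y i = 0) mulr0.
have [n Nn xh] : exists2 n, (N <= n)%N & normc (x n) < normc (h n).
  apply: contrapT => H.
  have : `|h| <= (e / 2)%:C.
    apply: (tailM' h N (leq_maxr _ _) h0) => i Ni.
    by rewrite leNgt; apply/negP => xh; apply: H; exists i.
  by rewrite hE lecR leNgt gtr_pMr// invf_lt1// ltr1n.
have hn0 : h n != 0.
  by apply: contraTN xh => /eqP ->; rewrite normc0 -leNgt normc_ge0.
exists ((x n / h n) *: h), n; split.
- exact: YZ.
- exact: leq_trans (leq_maxl _ _) Nn.
- move=> i iM; rewrite [LHS](_ : _ = (x n / h n) * h i)// (h0 i) ?mulr0//.
  exact: leq_trans iM (leq_maxl _ _).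
- rewrite normrZ hE ler_piMl ?ler0c ?(ltW e0)//.
  rewrite normrM normfV ler_pdivrMr ?normr_gt0// mul1r lecR.
  exact: ltW.
- by rewrite [LHS](_ : _ = (x n / h n) * h n)// divfK.
Qed.

(** * The limit of the corrections *)

(** The corrections are summable and each spares the coordinates already fixed,
so all the zeros created survive in the limit. *)
Lemma subspace_zeros (Y : set (lp p1)) :
  linear_subspace Y -> closed Y -> ~ finite_dimensional Y ->
  exists x, [/\ Y x, x != 0 & forall N, exists2 n, (N <= n)%N & x n = 0].
Proof.
move=> Ysub Ycl Yinf.
have [x0 [Yx0 x0n0 _]] :=
  exists_common_zero _ _ _ (fun i => lp_coord i : {scalar lp p1}) 0 Ysub Yinf.
have [m x0m] : exists m, x0 m != 0.
  apply: contrapT => /forallNP H; move/eqP: x0n0; apply; apply: val_inj.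
  by apply/funext => i; apply/eqP; apply: contra_notT (H i) => ?.
(* c k bounds the total size of the corrections made from stage k on. *)
pose c k : R := 2^-1 ^+ k.
have c_gt0 k : 0 < c k by rewrite exprn_gt0// invr_gt0.
have cE k : c k = c k.+1 + c k.+1.
  by rewrite /c exprS -[RHS]mulr2n -[RHS]mulr_natl mulrA mulfV ?mul1r//
    pnatr_eq0.
have /choice[f fP] : forall t : nat * (lp p1 * nat), exists r : lp p1 * nat,
    [/\ Y r.1, (t.2.2 <= r.2)%N, forall i, (i < t.2.2)%N -> r.1 i = 0,
      `|r.1| <= (c t.1.+1)%:C & r.1 r.2 = t.2.1 r.2].
  move=> [k [x M]].
  have [g [n H]] := lp_correction Y x M _ Ysub Yinf (c_gt0 k.+1).
  by exists (g, n).
(* A stage is a vector together with the length of its segment of final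
   coordinates; that length starts just after a nonzero coordinate of x0. *)
pose fix s k := if k is k'.+1 then
  ((s k').1 - (f (k', s k')).1, (f (k', s k')).2.+1) else (x0, m.+1).
pose X k := (s k).1; pose M k := (s k).2.
pose g k := (f (k, s k)).1; pose n k := (f (k, s k)).2.
have XS k : X k.+1 = X k - g k by [].
have MS k : M k.+1 = (n k).+1 by [].
have Yg k : Y (g k) by case: (fP (k, s k)).
have Mn k : (M k <= n k)%N by case: (fP (k, s k)).
have g0 k i : (i < M k)%N -> g k i = 0.
  by case: (fP (k, s k)) => _ _ + _ _; exact.
have gc k : `|g k| <= (c k.+1)%:C by case: (fP (k, s k)).
have gn k : g k (n k) = X k (n k) by case: (fP (k, s k)).
have Mlt k : (k < M k)%N by elim: k => // k IH; rewrite MS ltnS (leq_trans IH).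
have X_stable k j i : (k <= j)%N -> (i < M k)%N -> X j i = X k i /\ (i < M j)%N.
  move=> /subnK <-; elim: (j - k)%N => // d IH iM.
  have [XE iMd] := IH iM; rewrite addSn; split; last first.
    by rewrite MS ltnS (leq_trans (ltnW iMd)).
  by rewrite XS [LHS](_ : _ = X (d + k)%N i - g (d + k)%N i)// g0// subr0.
have X_cauchy k j : (k <= j)%N -> `|X j - X k| <= (c k - c j)%:C.
  move=> /subnK <-; elim: (j - k)%N => [|d IH].
    by rewrite add0n !subrr normr0.
  rewrite addSn XS addrAC; apply: le_trans (ler_normB _ _) _.
  apply: le_trans (lerD IH (gc _)) _.
  by rewrite -rmorphD lecR [c (d + k)%N]cE opprD addrA subrK.
have YX k : Y (X k).
  elim: k => // k IH; rewrite XS addrC -scaleN1r.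
  by case: Ysub => _ /(_ (-1) (g k) (X k)); rewrite !inE; exact.
(* Coordinate i is final from stage i on, since i < M i. *)
pose lim i := X i i.
have X_lim k i : (i < M k)%N -> X k i = lim i.
  move=> iM; have [ik|/ltnW ki] := leqP i k.
    by have [] := X_stable _ _ _ ik (Mlt i).
  by rewrite /lim; have [->] := X_stable _ _ _ ki iM.
have dist k : exists2 z : lp p1, `|z| <= (c k)%:C &
    lp_val z = (fun i => lim i - X k i).
  apply: lp_of_local_bound (ltW (c_gt0 k)) _ => N.
  exists (X (maxn k N) - X k).
    apply: le_trans (X_cauchy _ _ (leq_maxl _ _)) _.
    by rewrite lecR gerBl ltW.
  move=> i iN; rewrite [LHS](_ : _ = X (maxn k N) i - X k i)// X_lim//.
  exact: leq_trans (leq_trans iN (leq_maxr k N)) (ltnW (Mlt _)).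
have [z0 _ z0E] := dist 0.
pose x := X 0 + z0.
have xE i : x i = lim i.
  by rewrite [LHS](_ : _ = X 0 i + lp_val z0 i)// z0E addrC subrK.
exists x; split.
- apply: (closed_cvg _ Ycl (u_ := X) (F := \oo%classic)); first exact: nearW.
  apply/cvgrPdist_lt => eps eps0.
  have [e e0 ->] : exists2 e : R, 0 < e & eps = e%:C.
    case: eps eps0 => a b; rewrite ltcE/= => /andP[/eqP b0 a0].
    by exists a => //; rewrite b0.
  have : (c k @[k --> \oo] --> 0)%classic.
    by apply: cvg_expr; rewrite ger0_norm ?invf_lt1 ?ltr1n.
  move/cvgrPdist_lt => /(_ e e0); apply: filterS => k.
  rewrite sub0r normrN ger0_norm ?(ltW (c_gt0 k))// => cke.
  have [z zk zE] := dist k.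
  have -> : x - X k = z.
    apply: val_inj; apply/funext => i.
    by rewrite [RHS](_ : _ = lp_val z i)// zE -xE.
  by apply: le_lt_trans zk _; rewrite ltcR.
- apply: contra_neq x0m => x00.
  by rewrite -[x0]/(X 0) X_lim// -xE x00.
- move=> N; exists (n N); first exact: leq_trans (ltnW (Mlt N)) (Mn N).
  rewrite xE -(X_lim N.+1) ?MS// XS.
  by rewrite [LHS](_ : _ = X N (n N) - g N (n N))// gn subrr.
Qed.

End lp_tools.

Theorem corollary3p4 (R : realType) (p : R) (p1 : 1 <= p) :
  ~ spaceable (Zlp p1).
Proof.
move=> [Y [Ysub Ycl Yinf YZ]].
have [x [Yx xn0 x0]] := subspace_zeros p1 Y Ysub Ycl Yinf.
case: (YZ x Yx) => [|/eqP]; last by rewrite (negPf xn0).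
move=> /finite_seqP[s sE].
have [n + xn] := x0 (\max_(i <- s) i).+1.
have : n \in s by have : [set` s]%classic n by rewrite -sE.
move=> ns; rewrite ltnNge => /negP; apply.
exact: (leq_bigmax_seq (F := fun i : nat => i)).
Qed.
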